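(* Let $k,m\in\mathbb{N}$, let $X$ be a compact Hausdorff space, let $T_1,\dots,T_k:X\to X$ be commuting minimal homeomorphisms, let $U\subset X$ be a non-empty open set and, for each $i\in\{1,\dots,k\}$, let $a_i\in\mathbb{Z}[x]$ with $a_i(0)=0$ and let $b_i(n)=\left\lfloor a_i\big(n^{1/m}\big)\right\rfloor$. Then the set $$\left\{n:U\cap T_1^{-b_1(n)}U\cap\cdots\cap T_k^{-b_k(n)}U\neq\varnothing\right\}$$ (that is, its intersection with the set of $m$-th powers) is central$^*$ in the semigroup of $m$-th powers $\big(\{n^m:n\in\mathbb{N}\},\times\big)$.
   Context: $\mathbb{N}=\{1,2,\dots\}$. A homeomorphism $T:X\to X$ of a compact Hausdorff space is minimal if there is no non-empty proper compact subset $Y\subset X$ with $T^{-1}Y\subset Y$. For a (discrete) semigroup $S$, let $\beta S$ be the set of ultrafilters on $S$ with the semigroup operation extending that of $S$ ($A\in p\cdot q$ iff $\{x:\{y:xy\in A\}\in q\}\in p$). A subset of $S$ is central if it belongs to some minimal idempotent of $\beta S$, i.e. to some idempotent ultrafilter lying in the smallest two-sided ideal of $\beta S$. A subset of $S$ is central$^*$ if it has non-empty intersection with every central subset of $S$. *)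

(* Defs.v *)
From HB Require Import structures.
From mathcomp Require Import all_boot all_order all_algebra.
From mathcomp Require Import all_classical all_reals all_analysis.

Set Implicit Arguments.
Unset Strict Implicit.
Unset Printing Implicit Defensive.

Import Order.TTheory GRing.Theory Num.Theory.

Local Open Scope classical_set_scope.

Record beta (S : Type) := Beta {
  beta_sets :> set_system S;
  betaP : UltraFilter beta_sets }.

HB.instance Definition _ (S : Type) := gen_eqMixin (beta S).
HB.instance Definition _ (S : Type) := gen_choiceMixin (beta S).

Lemma beta_eq (S : Type) (p q : beta S) :
  beta_sets p = beta_sets q -> p = q.
Proof.
case: p q => [F hF] [G hG] /= FG; subst G.
by rewrite (Prop_irrelevance hF hG).
Qed.

Definition ultra_mul (S : semigroupType) (p q : set_system S) : set_system S :=
  [set A | p [set x | q [set y | A (x * y)%g]]].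

Lemma ultra_mul_ultra (S : semigroupType) (p q : beta S) :
  UltraFilter (ultra_mul p q).
Proof.
case: p q => [p pU] [q qU] /=.
have pqF : ProperFilter (ultra_mul p q).
  constructor=> [p0|].
    apply: (@filter_not_empty _ p _).
    move: p0; rewrite /ultra_mul /= => p0.
    by apply: filterS p0 => x /= q0; apply: (@filter_not_empty _ q _).
  constructor=> [|A B pA pB|A B AB].
  - by rewrite /ultra_mul /=; apply: filterE => x /=; apply: filterE.
  - move: pA pB; rewrite /ultra_mul /= => pA pB.
    apply: filterS2 pA pB => x /= qA qB.
    by apply: filterS2 qA qB => y /=.
  - rewrite /ultra_mul /= => pA; apply: filterS pA => x /= qA.
    by apply: filterS qA => y /=; exact: AB.
split=> // G GF pqG; apply/seteqP; split=> [A GA|]; last exact: pqG.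
have [//|pnA] := in_ultra_setVsetC [set x | q [set y | A (x * y)%g]] pU.
exfalso; apply: (@filter_not_empty _ G _).
rewrite -(setICr A); apply: filterI => //; apply: pqG.
apply: filterS pnA => x /= nqA.
by have [/nqA|] := in_ultra_setVsetC [set y | A (x * y)%g] qU.
Qed.

Definition beta_mul (S : semigroupType) (p q : beta S) : beta S :=
  Beta (ultra_mul_ultra p q).

Lemma beta_mulA (S : semigroupType) : associative (@beta_mul S).
Proof.
move=> p q r; apply: beta_eq; apply/funext => A /=.
rewrite /ultra_mul /=; congr (beta_sets p _).
apply/funext => x; congr (beta_sets q _); apply/funext => y.
by congr (beta_sets r _); apply/funext => z; rewrite /= mulgA.
Qed.

HB.instance Definition _ (S : semigroupType) :=
  isSemigroup.Build (beta S) (@beta_mulA S).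

Definition two_sided_ideal (S : semigroupType) (I : set S) : Prop :=
  I !=set0 /\ forall x y, I y -> I (x * y)%g /\ I (y * x)%g.

(* The intersection of all two-sided ideals; when [S] is some [beta S'], it is
   itself one (nonempty because [beta S'] is compact), hence the least one. *)
Definition smallest_ideal (S : semigroupType) : set S :=
  smallest (@two_sided_ideal S) set0.

Definition minimal_idempotent (S : semigroupType) (p : beta S) : Prop :=
  (p * p)%g = p /\ smallest_ideal p.

Definition central (S : semigroupType) (A : set S) : Prop :=
  exists2 p : beta S, minimal_idempotent p & beta_sets p A.

Definition central_star (S : semigroupType) (A : set S) : Prop :=
  forall C : set S, central C -> A `&` C !=set0.

Definition is_mth_power (m : nat) : pred nat :=
  fun x => `[< exists2 n : nat, (0 < n)%N & x = (n ^ m)%N >].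

Definition mth_powers (m : nat) : Type := {x : nat | is_mth_power m x}.

HB.instance Definition _ (m : nat) := SubChoice.on (mth_powers m).

Lemma mth_powerM (m x y : nat) :
  is_mth_power m x -> is_mth_power m y -> is_mth_power m (x * y)%N.
Proof.
move=> /asboolP[a a0 ->] /asboolP[b b0 ->]; apply/asboolP.
by exists (a * b)%N; rewrite ?muln_gt0 ?a0 ?expnMn.
Qed.

Definition mth_power_mul (m : nat) (x y : mth_powers m) : mth_powers m :=
  exist _ (val x * val y)%N (mth_powerM (valP x) (valP y)).

Lemma mth_power_mulA (m : nat) : associative (@mth_power_mul m).
Proof. by move=> x y z; apply: val_inj; rewrite /= mulnA. Qed.

HB.instance Definition _ (m : nat) :=
  isSemigroup.Build (mth_powers m) (@mth_power_mulA m).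

Definition homeomorphism (X Y : topologicalType) (f : X -> Y) : Prop :=
  exists g : Y -> X, [/\ cancel f g, cancel g f, continuous f & continuous g].

Definition minimal (X : topologicalType) (T : X -> X) : Prop :=
  ~ exists Y : set X,
      [/\ Y !=set0, Y <> [set: X], compact Y & T @^-1` Y `<=` Y].

(* The set T^(-z) U; only meaningful for bijective [T], for which the image of
   [U] under [iter n T] is its preimage under the [n]-th iterate of the inverse
   of [T]. *)
Definition preimagez (X : Type) (T : X -> X) (z : int) (U : set X) : set X :=
  match z with
  | Posz n => iter n T @^-1` U
  | Negz n => iter n.+1 T @` U
  end.

Definition floor_poly_root (R : realType) (m : nat) (a : {poly int}) (n : nat)
    : int :=
  Num.floor ((map_poly intr a).[n%:R `^ (m%:R^-1)] : R)%R.

(* Main.v *)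
Require Import Defs.
From HB Require Import structures.
From mathcomp Require Import all_boot all_order all_algebra.
From mathcomp Require Import ring finmap.
From mathcomp Require Import all_classical all_reals all_analysis.

(** For n = N ^ m the exponent floor (a_i (n ^ (1/m))) is just a_i(N), and the
m-th powers under multiplication are a copy of the positive integers under
multiplication. So the claim is that multiplicatively central sets of N meet
the set of return times of U along the integer polynomials a_i. Two facts give
this.

The first is the polynomial van der Waerden theorem, in the form
[poly_vdw_all]: for finitely many polynomials p over an integral domain R with
p(0) = 0, every finite colouring of R is constant on some v, v + p(n), with
n > 0. The proof is induction on the degrees and leading coefficients of the
family (PET induction): replacing p(x) by p(x + d) - p(d) - p0(x), where p0 has
least degree in the family, makes the family simpler, and the simpler families
allow colour focusing ([focusing]). Keeping (v, n) in a finite window that is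
independent of the colouring costs nothing and replaces all compactness
arguments. Applied to polynomials whose coefficients are independent
indeterminates, the theorem yields one finite set of n that serves all families
of bounded length and degree at once, over every R ([uniform_poly_vdw]).

The second is a soft argument on ultrafilters. Call a set of integers rich if
for each bound on length, degree and number of colours it contains a finite set
of such n. Richness is partition regular, because two bad colourings can be
multiplied; hence there is an ultrafilter consisting of rich sets. The
uniformity in the coefficients makes richness of finite pieces invariant under
n |-> d * n, and so the ultrafilters consisting of rich sets form a two-sided ideal
([rich_ideal_two_sided]). It contains the smallest ideal, that is, central sets
are rich ([central_rich]).

To conclude, the additive group of {poly int} acts on X, the coefficient of
'X^i acting through iterates of T_i. By minimality of one T_i and compactness,
finitely many of its iterates pull U back to a cover of X. Colour f by the
member of the cover that contains the translate by f of a fixed point. A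
monochromatic configuration v, v + a_i(N) 'X^i gives, after translation, a
point of U which T_i^(a_i(N)) sends into U for every i. *)

Set Implicit Arguments.
Unset Strict Implicit.
Unset Printing Implicit Defensive.

Import Order.TTheory GRing.Theory Num.Theory.

Local Open Scope classical_set_scope.
Local Open Scope ring_scope.

(** * The polynomial van der Waerden theorem *)

(** A window W that does not depend on the colouring c is what lets the induction
colour by finite patterns instead of single points. *)
Definition poly_vdw (R : idomainType) (A : seq {poly R}) : Prop :=
  forall C : finType, exists W : seq (R * nat), forall c : R -> C,
    exists v n, [/\ (v, n) \in W, (0 < n)%N &
      forall p, p \in A -> c (v + p.[n%:R]) = c v].

(** The PET operation. Given p(d) as an earlier step, adding n to the step d
moves v + p(d) by p(d + n) - p(d); subtracting p0 accounts for the fact that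
the base point moves by - p0(n) at the same time. *)
Definition pet_shift (R : idomainType) (p0 : {poly R}) (d : nat) (p : {poly R}) :
  {poly R} := p \Po ('X + d%:R%:P) - p.[d%:R]%:P - p0.

Lemma horner_pet_shift (R : idomainType) (p0 p : {poly R}) (d n : nat) :
  (pet_shift p0 d p).[n%:R] = p.[(d + n)%:R] - p.[d%:R] - p0.[n%:R].
Proof. by rewrite /pet_shift !hornerE horner_comp !hornerE natrD [_ + n%:R]addrC. Qed.

(** The points w + p(d), for p in the family, form for each fixed d one
monochromatic fan at w. The fans for different d in ds have different colours,
so that there are at most as many of them as colours. The polynomial p0 of the
family serves to name the colour of a fan. *)
Definition focused (R : idomainType) (C : finType) (A : seq {poly R})
    (p0 : {poly R}) (c : R -> C) (w : R) (ds : seq nat) : Prop :=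
  [/\ all (ltn 0) ds, uniq [seq c (w + p0.[d%:R]) | d : nat <- ds] &
    forall d p, d \in ds -> p \in A -> c (w + p.[d%:R]) = c (w + p0.[d%:R])].

Definition hit (R : idomainType) (C : finType) (A : seq {poly R})
    (c : R -> C) (w : R) (d : nat) : Prop :=
  (0 < d)%N /\ forall p, p \in A -> c (w + p.[d%:R]) = c w.

(** Colour focusing: either the number of fans with distinct colours at a common
focus can be increased by one, or the focus itself shares its colour with one of
the fans, which completes a monochromatic configuration. To increase it, colour
each point v by the pattern that c shows on the whole window around v, and use
the hypothesis to find v and n such that this pattern is repeated at
v + pet_shift p0 d p (n). A focus w with fans d in the window at v then yields the
focus v + w - p0(n) with fans d + n of the same colours, and one more fan n of
the colour of the old focus v + w. *)
Lemma focusing (R : idomainType) (C : finType) (A : seq {poly R}) (p0 : {poly R}) :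
  p0 \in A -> (forall p, p \in A -> p.[0] = 0) ->
  (forall D : seq nat, poly_vdw [seq pet_shift p0 d p | d <- D, p <- A]) ->
  forall j, exists W : seq (R * seq nat), forall c : R -> C,
    exists w ds, (w, ds) \in W /\
      (size ds = j /\ focused A p0 c w ds \/ exists2 d, d \in ds & hit A c w d).
Proof.
move=> p0A A0 IH; elim=> [|j [W HW]].
  by exists [:: (0, [::])] => c; exists 0, [::]; rewrite inE eqxx; split=> //; left.
(* The step 0 is included because the old focus w = w + p(0) becomes a fan. *)
pose D := 0%N :: flatten [seq w.2 | w <- W].
pose offs := [seq w.1 + x | w <- W, x <- [seq p.[d%:R] | d : nat <- D, p <- A]].
have [W1 HW1] := IH D ((size offs).-tuple C : finType).
pose shifts := [seq (u.1 + w.1, w.2) | u <- W1, w <- W].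
pose refocus := [seq (u.1 + w.1 - p0.[u.2%:R], u.2 :: [seq (d + u.2)%N | d <- w.2])
  | u <- W1, w <- W].
exists (shifts ++ refocus) => c.
have [v [n [vW1 n0 Hv]]] := HW1 (fun v => map_tuple (fun o => c (v + o)) (in_tuple offs)).
have {}Hv d p o : d \in D -> p \in A -> o \in offs ->
    c (v + (p.[(d + n)%:R] - p.[d%:R] - p0.[n%:R]) + o) = c (v + o).
  move=> dD pA oo; have /(congr1 val) /= := Hv _ (allpairs_f (pet_shift p0) dD pA).
  by rewrite horner_pet_shift => /eq_in_map/(_ o oo).
have [w [ds [wW Hw]]] := HW (fun u => c (v + u)).
have inS : (v + w, ds) \in shifts by apply/allpairsP; exists ((v, n), (w, ds)).
have inF : (v + w - p0.[n%:R], n :: [seq (d + n)%N | d <- ds]) \in refocus.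
  by apply/allpairsP; exists ((v, n), (w, ds)).
have dsD d : d \in ds -> d \in D.
  move=> dds; rewrite inE; apply/orP; right; apply/flattenP; exists ds => //.
  by apply/mapP; exists (w, ds).
have offsP d p : d \in D -> p \in A -> w + p.[d%:R] \in offs.
  move=> dD pA; apply/allpairsP; exists ((w, ds), p.[d%:R]); split=> //.
  exact: (allpairs_f (fun (d : nat) p => p.[d%:R])).
have D0 : 0%N \in D by rewrite inE.
have woffs : w \in offs by have := offsP _ _ D0 p0A; rewrite A0 // addr0.
have hitE d : hit A (fun u => c (v + u)) w d -> hit A c (v + w) d.
  by case=> d0 dA; split=> // p pA; rewrite -addrA dA.
case: Hw => [[szds [ds0 dsU dsA]]|[d dds hd]]; last first.
  exists (v + w), ds; split; first by rewrite mem_cat inS.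
  by right; exists d => //; exact: hitE.
have [/mapP[d dds cd]|new] := boolP (c (v + w) \in
    [seq c (v + (w + p0.[d%:R])) | d : nat <- ds]).
  exists (v + w), ds; split; first by rewrite mem_cat inS.
  right; exists d => //; apply: hitE; split; first exact: (allP ds0).
  by move=> p pA; rewrite dsA.
set w' := v + w - p0.[n%:R] in inF.
have near p : p \in A -> c (w' + p.[n%:R]) = c (v + w).
  move=> pA; have := Hv _ _ _ D0 pA woffs; rewrite add0n A0 // subr0 => <-.
  by congr c; rewrite /w'; ring.
have far d p : d \in ds -> p \in A -> c (w' + p.[(d + n)%:R]) = c (v + (w + p.[d%:R])).
  move=> dds pA; rewrite -(Hv d p) //; [|exact: dsD|by apply: offsP => //; exact: dsD].
  by congr c; rewrite /w'; ring.
exists w', (n :: [seq (d + n)%N | d <- ds]); split; first by rewrite mem_cat inF orbT.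
left; split; first by rewrite /= size_map szds.
split.
- rewrite /= n0; apply/allP => _ /mapP[d /(allP ds0) /= d0 ->].
  by rewrite ltn_addr.
- rewrite /= near // -map_comp.
  rewrite (_ : [seq _ | _ <- ds] = [seq c (v + (w + p0.[d%:R])) | d : nat <- ds]).
    by rewrite new.
  by apply/eq_in_map => d dds /=; rewrite far.
move=> d p; rewrite inE => /predU1P[->|/mapP[e eds ->]] pA; first by rewrite !near.
by rewrite !far // dsA.
Qed.

(** With one more fan than there are colours, focusing can only end in a
monochromatic configuration. *)
Lemma poly_vdw_step (R : idomainType) (A : seq {poly R}) (p0 : {poly R}) :
  p0 \in A -> (forall p, p \in A -> p.[0] = 0) ->
  (forall D : seq nat, poly_vdw [seq pet_shift p0 d p | d <- D, p <- A]) ->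
  poly_vdw A.
Proof.
move=> p0A A0 IH C; have [W HW] := focusing C p0A A0 IH #|C|.+1.
exists (flatten [seq [seq (w.1, d) | d <- w.2] | w <- W]) => c.
have [w [ds [wW [[szds [_ dsU _]]|[d dds [d0 hd]]]]]] := HW c.
  have := max_card (mem [seq c (w + p0.[d%:R]) | d : nat <- ds]).
  by rewrite (card_uniqP dsU) size_map szds ltnn.
exists w, d; split=> //; apply/flatten_mapP; exists (w, ds) => //=.
by apply/mapP; exists d.
Qed.

(** Induction along the lexicographic order on weights w, the coordinate D - 1
being the most significant one. The coordinates above the one that decreases
are only required not to increase, which spares comparing them exactly. *)
Lemma lex_ind (D : nat) (Q : (nat -> nat) -> Prop) :
  (forall w, (forall w' j, (j < D)%N -> (w' j < w j)%N ->
     (forall i, (j < i < D)%N -> (w' i <= w i)%N) -> Q w') -> Q w) ->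
  forall w, Q w.
Proof.
elim: D Q => [|D IHD] Q HQ; first by move=> w; apply: HQ.
suff main v w : (w D <= v)%N -> Q w by move=> w; exact: (main (w D)).
elim/ltn_ind: v w => v IHv.
apply: (IHD (fun w => (w D <= v)%N -> Q w)) => w IHw wv.
apply: HQ => w' j; rewrite ltnS leq_eqVlt => /predU1P[->|jD] w'w w'le.
  by apply: (IHv (w' D)) => //; exact: leq_trans wv.
apply: (IHw w' j) => //.
  by move=> i /andP[ji iD]; apply: w'le; rewrite ji ltnW.
by apply: leq_trans wv; apply: w'le; rewrite jD ltnSn.
Qed.

(** The weight of PET induction: the number of distinct leading coefficients in
each degree, the degree being j - 1. *)
Definition lead_coefs (R : idomainType) (A : seq {poly R}) (j : nat) : seq R :=
  undup [seq lead_coef p | p : {poly R} <- A & size p == j].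

Lemma lead_coefsP (R : idomainType) (A : seq {poly R}) (j : nat) (x : R) :
  reflect (exists p, [/\ p \in A, size p = j & lead_coef p = x]) (x \in lead_coefs A j).
Proof.
rewrite mem_undup; apply: (iffP mapP) => [[p]|[p [pA sp <-]]].
  by rewrite mem_filter => /andP[/eqP sp pA] ->; exists p.
by exists p => //; rewrite mem_filter sp eqxx.
Qed.

Lemma size_shift (R : idomainType) (p : {poly R}) (a : R) :
  size (p \Po ('X + a%:P)) = size p.
Proof. by rewrite size_comp_poly2 // size_XaddC. Qed.

Lemma lead_coef_shift (R : idomainType) (p : {poly R}) (a : R) :
  lead_coef (p \Po ('X + a%:P)) = lead_coef p.
Proof.
by rewrite lead_coef_comp ?size_XaddC // lead_coefXaddC expr1n mulr1.
Qed.

Lemma size_pet_shift (R : idomainType) (p0 p : {poly R}) (d : nat) :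
  (1 < size p0 < size p)%N ->
  size (pet_shift p0 d p) = size p /\ lead_coef (pet_shift p0 d p) = lead_coef p.
Proof.
case/andP=> p01 p0p.
have small : (size (- p.[d%:R]%:P - p0)%R < size (p \Po ('X + d%:R%:P)))%N.
  rewrite size_shift (leq_ltn_trans (size_polyD _ _)) // !size_polyN gtn_max p0p andbT.
  by apply: leq_ltn_trans (size_polyC_leq1 _) _; apply: ltn_trans p0p.
by rewrite /pet_shift -addrA size_polyDl ?lead_coefDl // size_shift lead_coef_shift.
Qed.

Lemma coef_pet_shift (R : idomainType) (p0 p : {poly R}) (d : nat) :
  (1 < size p0)%N -> size p0 = size p ->
  (size (pet_shift p0 d p) <= size p0)%N /\
  (pet_shift p0 d p)`_(size p0).-1 = lead_coef p - lead_coef p0.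
Proof.
move=> p01 sp; split.
  rewrite (leq_trans (size_polyD _ _)) // size_polyN geq_max leqnn andbT.
  rewrite (leq_trans (size_polyD _ _)) // size_polyN size_shift geq_max sp leqnn /=.
  by apply: leq_trans (size_polyC_leq1 _) _; rewrite -sp ltnW.
rewrite /pet_shift !coefB coefC.
rewrite -subn1 subn_eq0 leqNgt p01 /= subr0 subn1; congr (_ - _).
by rewrite sp -(size_shift p d%:R) -lead_coefE lead_coef_shift.
Qed.

Lemma pet_shift0 (R : idomainType) (p0 p : {poly R}) (d : nat) :
  p0.[0] = 0 -> (pet_shift p0 d p).[0] = 0.
Proof.
move=> h; have := horner_pet_shift p0 p d 0.
by rewrite addn0 subrr h subrr.
Qed.

Lemma horner0_size (R : idomainType) (p : {poly R}) :
  p.[0] = 0 -> p != 0 -> (1 < size p)%N.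
Proof.
move=> h p0; rewrite ltnNge; apply: contra p0 => /size1_polyC E.
by move: h; rewrite {1}E hornerC => c0; rewrite E c0.
Qed.

(** Above the degree of p0, shifting changes neither degree nor leading
coefficient, so that no new leading coefficients appear there. *)
Lemma lead_coefs_gt (R : idomainType) (A : seq {poly R}) (p0 : {poly R})
    (D : seq nat) (j : nat) :
  (forall p, p \in A -> size p0 <= size p)%N -> (1 < size p0 < j)%N ->
  (size (lead_coefs [seq pet_shift p0 d p | d <- D, p <- A] j) <=
   size (lead_coefs A j))%N.
Proof.
move=> pmin /andP[p01 p0j]; apply: uniq_leq_size (undup_uniq _) _ => x.
case/lead_coefsP=> _ [/allpairsP[[d p] [_ pA ->]] sq <-]; rewrite /= in pA sq *.
have := pmin p pA; rewrite leq_eqVlt => /predU1P[sp|sp].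
  by have [] := coef_pet_shift d p01 sp; rewrite sq leqNgt p0j.
have [|sqp ->] := @size_pet_shift _ p0 p d; first by rewrite p01 sp.
by apply/lead_coefsP; exists p; rewrite -sqp.
Qed.

(** In the degree of p0, each leading coefficient is lowered by that of p0, and
the polynomials that share the leading coefficient of p0 drop to lower
degree: one leading coefficient disappears. *)
Lemma lead_coefs_eq (R : idomainType) (A : seq {poly R}) (p0 : {poly R}) (D : seq nat) :
  p0 \in A -> (forall p, p \in A -> size p0 <= size p)%N -> (1 < size p0)%N ->
  (size (lead_coefs [seq pet_shift p0 d p | d <- D, p <- A] (size p0)) <
   size (lead_coefs A (size p0)))%N.
Proof.
move=> p0A pmin p01; set L := lead_coefs A _.
have p0L : lead_coef p0 \in L by apply/lead_coefsP; exists p0.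
have -> : size L = (size [seq x - lead_coef p0 | x <- rem (lead_coef p0) L]).+1.
  by rewrite size_map size_rem // prednK //; case: L p0L.
rewrite ltnS; apply: uniq_leq_size (undup_uniq _) _ => x.
case/lead_coefsP=> _ [/allpairsP[[d p] [_ pA ->]] sq <-]; rewrite /= in pA sq *.
have := pmin p pA; rewrite leq_eqVlt => /predU1P[sp|sp]; last first.
  have [|sqp _] := @size_pet_shift _ p0 p d; first by rewrite p01 sp.
  by move: sp; rewrite -sqp sq ltnn.
have [_ cq] := coef_pet_shift d p01 sp.
have lq : lead_coef (pet_shift p0 d p) = lead_coef p - lead_coef p0.
  by rewrite lead_coefE sq.
apply/mapP; exists (lead_coef p) => //.
rewrite mem_rem_uniq ?undup_uniq // inE; apply/andP; split; last first.
  by apply/lead_coefsP; exists p.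
rewrite -subr_eq0 -lq lead_coef_eq0 -size_poly_gt0 sq.
exact: ltnW.
Qed.

Lemma poly_vdw_nz (R : idomainType) (A : seq {poly R}) :
  poly_vdw [seq p <- A | p != 0] -> poly_vdw A.
Proof.
move=> H C; have [W HW] := H C; exists W => c.
have [v [n [vW n0 Hv]]] := HW c; exists v, n; split=> // p pA.
have [->|pn0] := eqVneq p 0; first by rewrite horner0 addr0.
by apply: Hv; rewrite mem_filter pn0.
Qed.

Lemma lead_coefs_sub (R : idomainType) (A B : seq {poly R}) (j : nat) :
  {subset A <= B} -> (size (lead_coefs A j) <= size (lead_coefs B j))%N.
Proof.
move=> AB; apply: uniq_leq_size (undup_uniq _) _ => x /lead_coefsP[p [pA sp lp]].
by apply/lead_coefsP; exists p; split=> //; exact: AB.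
Qed.

(** The polynomial van der Waerden theorem. Zero polynomials are discarded before
each step, because p0 must have least degree among nonzero polynomials: a zero
polynomial would contribute the new leading coefficient of - p0. *)
Theorem poly_vdw_all (R : idomainType) (A : seq {poly R}) :
  (forall p, p \in A -> p.[0] = 0) -> poly_vdw A.
Proof.
pose D := (\max_(p <- A) size p).+1.
have : forall p : {poly R}, p \in A -> (size p < D)%N.
  by move=> p pA; rewrite ltnS (@leq_bigmax_seq _ A xpredT (fun p : {poly R} => size p)).
move: D => D; have := erefl (fun j => size (lead_coefs A j)).
move: {2}(fun j => _) => w.
elim/(@lex_ind D): w A => w IH A wE AD A0.
apply: poly_vdw_nz; set B := [seq p <- A | p != 0].
have BA : {subset B <= A} by move=> p; rewrite mem_filter => /andP[].
case: (posnP (size B)) => [/size0nil ->|B0].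
  by move=> C; exists [:: (0, 1%N)] => c; exists 0, 1%N; rewrite inE eqxx.
have [p0 p0B pmin] : exists2 p0, p0 \in B &
    forall p, p \in B -> (size (p0 : {poly R}) <= size (p : {poly R}))%N.
  pose s := sort (relpre (fun p : {poly R} => size p) leq) B.
  have : sorted (relpre (fun p : {poly R} => size p) leq) s.
    by apply: sort_sorted => p q; exact: leq_total.
  have sB : s =i B by move=> p; rewrite mem_sort.
  have: (0 < size s)%N by rewrite size_sort.
  case: s sB => //= p0 s sB _ sS; exists p0; first by rewrite -sB inE eqxx.
  move=> p; rewrite -sB inE => /predU1P[->//|ps].
  have tr : transitive (relpre (fun p : {poly R} => size p) leq).
    by move=> ? ? ?; exact: leq_trans.
  by have /allP/(_ p ps) := order_path_min tr sS.
have p01 : (1 < size p0)%N.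
  by move: (p0B); rewrite mem_filter => /andP[n0 /A0 h]; exact: horner0_size.
apply: (poly_vdw_step p0B) => [p /BA/A0//|E].
have p0D : (size p0 < D)%N by exact/AD/BA.
pose A' := [seq pet_shift p0 d p | d <- E, p <- B].
apply: (IH (fun j => size (lead_coefs A' j)) (size p0)) => //.
- by rewrite -wE (leq_trans (lead_coefs_eq E p0B pmin p01)) // lead_coefs_sub.
- move=> i /andP[p0i _]; rewrite -wE.
  apply: (leq_trans _ (lead_coefs_sub i BA)).
  by apply: lead_coefs_gt => //; rewrite p01.
- move=> _ /allpairsP[[d p] /= [_ pB ->]].
  have := pmin p pB; rewrite leq_eqVlt => /predU1P[sp|sp].
    by apply: leq_ltn_trans p0D; case: (coef_pet_shift d p01 sp).
  have [|-> _] := @size_pet_shift _ p0 p d; first by rewrite p01 sp.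
  exact/AD/BA.
- by move=> _ /allpairsP[[d p] /= [_ _ ->]]; apply/pet_shift0/A0/BA.
Qed.

(** * Uniformity in the coefficients *)

(** The generic family: its i-th member is the sum over j of the monomials with
coefficient unknown i j in degree j + 1. The map specialize sends unknown i j
to the coefficient of degree j + 1 of the i-th member of P. It is only additive,
not multiplicative, and this is enough, since the configurations use only the
addition of the values: integer evaluation points act by repeated addition. *)
Section Universal.
Variables (R : idomainType) (P : seq {poly R}) (K D : nat).

Definition specialize (f : {poly {poly int}}) : R :=
  \sum_(i < K) \sum_(j < D) P`_i`_j.+1 *~ f`_i`_j.

Lemma specializeD f g : specialize (f + g) = specialize f + specialize g.
Proof.
rewrite /specialize -big_split; apply: eq_bigr => i _ /=.
by rewrite -big_split; apply: eq_bigr => j _ /=; rewrite !coefD mulrzDr.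
Qed.
End Universal.

Definition unknown (i j : nat) : {poly {poly int}} := ('X^j : {poly int}) *: 'X^i.

Lemma coef_unknown (i j i' j' : nat) :
  (unknown i j)`_i'`_j' = ((i' == i) && (j' == j))%:R.
Proof.
rewrite /unknown coefZ coefXn; case: eqP => _; last by rewrite mulr0 coef0.
by rewrite mulr1 coefXn.
Qed.

Definition universal_poly (D i : nat) : {poly {poly {poly int}}} :=
  \sum_(j < D) unknown i j *: 'X^(j.+1).

Lemma horner_universal (D i n : nat) :
  (universal_poly D i).[n%:R] = \sum_(j < D) unknown i j *+ (n ^ j.+1).
Proof.
rewrite /universal_poly horner_sum; apply: eq_bigr => j _.
by rewrite !hornerE -natrX mulr_natr.
Qed.

Lemma specialize_universal (R : idomainType) (P : seq {poly R}) (K D i n : nat) :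
  (i < K)%N -> (size (P`_i)%R <= D)%N -> (P`_i).[0] = 0 ->
  specialize P K D (universal_poly D i).[n%:R] = (P`_i).[n%:R].
Proof.
move=> iK sD P0; rewrite horner_universal (horner_coef_wide _ (leqW sD)).
rewrite big_ord_recl -horner_coef0 P0 mul0r add0r /specialize.
rewrite (bigD1 (Ordinal iK)) //= [X in _ + X]big1 ?addr0.
  apply: eq_bigr => j _; rewrite !coef_sum (bigD1 j) //= big1 ?addr0.
    by rewrite !coefMn coef_unknown !eqxx -natrX mulr_natr /= natz -pmulrn.
  move=> l lj; rewrite !coefMn coef_unknown eqxx.
  by rewrite [_ == _ :> nat]eq_sym (inj_eq val_inj) (negPf lj) mul0rn.
move=> l li; rewrite big1 // => j _; rewrite !coef_sum big1 ?mulr0z // => h _.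
by rewrite !coefMn coef_unknown -[_ == i]/(l == Ordinal iK) (negPf li) mul0rn.
Qed.

(** Bounding the number and the degree of the polynomials, but not their
coefficients, makes this notion stable under dilation of ns. *)
Definition catches (R : idomainType) (K D : nat) (C : finType) (ns : seq nat) : Prop :=
  forall (P : seq {poly R}) (c : R -> C), (size P <= K)%N ->
    (forall p : {poly R}, p \in P -> (size p <= D)%N /\ p.[0] = 0) ->
    exists v n, n \in ns /\ forall p, p \in P -> c (v + p.[n%:R]) = c v.

(** Pulling a colouring back along specialize transfers the theorem from the
generic family to any other, with the same window. *)
Lemma uniform_poly_vdw (K D : nat) (C : finType) :
  exists2 ns : seq nat, all (ltn 0) ns & forall R : idomainType, catches R K D C ns.
Proof.
have A0 p : p \in [seq universal_poly D i | i <- iota 0 K] -> p.[0] = 0.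
  case/mapP=> i _ ->; have := horner_universal D i 0; rewrite mulr0n => ->.
  by rewrite big1 // => j _; rewrite exp0n.
have [W HW] := poly_vdw_all A0 C.
exists [seq n <- [seq w.2 | w <- W] | (0 < n)%N]; first exact: filter_all.
move=> R P c sP PD.
have [v [n [vW n0 Hv]]] := HW (c \o specialize P K D).
exists (specialize P K D v), n; split.
  by rewrite mem_filter n0; apply/mapP; exists (v, n).
move=> p pP; have [i iP <-] := nthP 0 pP.
have iK := leq_trans iP sP.
have [sD p0] := PD _ (mem_nth 0 iP).
rewrite -(specialize_universal n iK sD p0) -specializeD; apply: Hv.
by apply: map_f; rewrite mem_iota.
Qed.

Definition dilate (R : idomainType) (d : nat) (p : {poly R}) : {poly R} :=
  p \Po (d%:R *: 'X).

Lemma horner_dilate (R : idomainType) (d : nat) (p : {poly R}) (n : nat) :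
  (dilate d p).[n%:R] = p.[(d * n)%:R].
Proof. by rewrite /dilate horner_comp !hornerE natrM. Qed.

Lemma size_dilate (R : idomainType) (d : nat) (p : {poly R}) :
  (size (dilate d p) <= size p)%N.
Proof.
have [->|pn0] := eqVneq p 0; first by rewrite /dilate comp_poly0.
apply: leq_trans (size_comp_poly_leq _ _) _; rewrite -[leqRHS]prednK ?size_poly_gt0 //.
rewrite ltnS -[leqRHS]muln1 leq_mul // -subn1 leq_subLR.
by rewrite (leq_trans (size_scale_leq _ _)) ?size_polyX.
Qed.

(** The dilated polynomials p(d x) obey the same bounds as p; this is where
uniformity in the coefficients pays off. *)
Lemma catches_dilate (R : idomainType) (K D : nat) (C : finType) (d : nat)
    (ns : seq nat) :
  catches R K D C ns -> catches R K D C [seq (d * n)%N | n <- ns].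
Proof.
move=> H P c sP dP; have [||v [n [nN Hn]]] := H (map (dilate d) P) c.
- by rewrite size_map.
- move=> _ /mapP[p /dP[sp p0] ->]; split; first exact: leq_trans (size_dilate _ _) sp.
  by rewrite /dilate horner_comp !hornerE.
exists v, (d * n)%N; split; first exact: map_f.
by move=> p pP; rewrite -horner_dilate; apply/Hn/map_f.
Qed.

(** * Rich sets and the smallest ideal *)

(** The example in view is the semigroup of m-th powers, with rho the m-th root. *)
Section Rich.
Variables (R : idomainType) (S : semigroupType) (rho : S -> nat).

(** The finite set F depends on the bounds only. Finiteness is what allows all of
F to be translated into a set at once by a single multiplier. *)
Definition rich (B : set S) : Prop :=
  forall (K D : nat) (C : finType), exists2 F : seq S, (forall x, x \in F -> B x) &
    catches R K D C (map rho F).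

Lemma richS (A B : set S) : A `<=` B -> rich A -> rich B.
Proof.
move=> AB rA K D C; have [F FA HF] := rA K D C.
by exists F => // x /FA/AB.
Qed.

Lemma rich0 : ~ rich set0.
Proof.
move=> /(_ 0%N 0%N unit)[F F0 HF].
by have [//|v [n [/mapP[x /F0]]]] := HF [::] (fun=> tt) isT.
Qed.

(** Colourings c1 and c2 that defeat the parts of F in A and in B combine to the
colouring (c1, c2), which defeats F for the concatenated family. *)
Lemma richU (A B : set S) : rich (A `|` B) -> rich A \/ rich B.
Proof.
move=> rAB; apply: contrapT => /not_orP[nA nB].
apply: nA => K1 D1 C1; apply: contrapT => n1.
apply: nB => K2 D2 C2; apply: contrapT => n2.
have [F FAB HF] := rAB (K1 + K2)%N (maxn D1 D2) (C1 * C2 : finType)%type.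
apply: n1; exists [seq x <- F | `[< A x >]].
  by move=> x; rewrite mem_filter => /andP[/asboolP].
move=> P1 c1 sP1 dP1; apply: contrapT => n1.
apply: n2; exists [seq x <- F | `[< B x >]].
  by move=> x; rewrite mem_filter => /andP[/asboolP].
move=> P2 c2 sP2 dP2; apply: contrapT => n2.
have [||v [_ [/mapP[x xF ->] Hx]]] := HF (P1 ++ P2) (fun v => (c1 v, c2 v)).
- by rewrite size_cat leq_add.
- move=> p; rewrite mem_cat leq_max => /orP[/dP1[-> ->]|/dP2[-> ->]] //.
  by rewrite orbT.
have [Ax|Bx] := FAB x xF.
  apply: n1; exists v, (rho x); split.
    by apply: map_f; rewrite mem_filter xF andbT; apply/asboolP.
  by move=> p pP; apply: (congr1 fst (Hx p _)); rewrite mem_cat pP.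
apply: n2; exists v, (rho x); split.
  by apply: map_f; rewrite mem_filter xF andbT; apply/asboolP.
by move=> p pP; apply: (congr1 snd (Hx p _)); rewrite mem_cat pP orbT.
Qed.

Hypothesis rhoM : forall x y, rho (x * y)%g = (rho x * rho y)%N.
Hypothesis rho_surj : forall n, (0 < n)%N -> exists x, rho x = n.

Lemma richT : rich setT.
Proof.
move=> K D C; have [ns ns0 Hns] := uniform_poly_vdw K D C.
have /choice[g gE] n : exists x, rho x = maxn n 1.
  by apply: rho_surj; rewrite leq_max orbT.
exists (map g ns) => //; rewrite -map_comp.
rewrite (_ : [seq _ | _ <- ns] = ns) // -[RHS]map_id.
by apply/eq_in_map => n /(allP ns0) n0 /=; rewrite gE (maxn_idPl n0).
Qed.

(** The complements of sets that are not rich form a proper filter; any ultrafilter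
above it will do. *)
Lemma rich_ultra : exists q : beta S, forall A, beta_sets q A -> rich A.
Proof.
pose F : set_system S := [set A | ~ rich (~` A)].
have FF : ProperFilter F.
  split; first by rewrite /F /= setC0 => /(_ richT).
  split; first by rewrite /F /= setCT; exact: rich0.
    by move=> A B nA nB; rewrite /F /= setCI => /richU[].
  by move=> A B AB nA; apply: contra_not nA; apply: richS; apply: subsetC.
have [G [GU FG]] := ultraFilterLemma FF.
exists (Beta GU) => A /= GA; apply: contrapT => nA.
have : G (~` A) by apply: FG; rewrite /F /= setCK.
move=> GnA; apply: (@filter_not_empty _ G _).
by rewrite -(setICr A); apply: filterI.
Qed.

Definition rich_ideal : set (beta S) := [set q | forall A, beta_sets q A -> rich A].

(** In a member A of p q, some quotient x^-1 A belongs to q; in a member A of q p,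
the x with x^-1 A in p form a member of q, and the finitely many x in its finite
piece F have a common y with F y inside A. Either way A contains a dilate of a
finite piece of a member of q. *)
Lemma rich_ideal_two_sided : two_sided_ideal rich_ideal.
Proof.
split=> [|p q qr]; first by have [q ?] := rich_ultra; exists q.
split=> A.
- move=> pqA; have [x xA] : exists x, beta_sets q [set y | A (x * y)%g].
    by apply: (@filter_ex _ _ (@ultra_proper _ _ (betaP p))); exact: pqA.
  move=> K D C; have [F FA HF] := qr _ xA K D C.
  exists [seq (x * y)%g | y <- F] => [_ /mapP[y /FA yA ->] //|].
  have := catches_dilate (rho x) HF; rewrite -!map_comp.
  by under eq_map => y do rewrite /= -rhoM.
- move=> qpA K D C; have [F FA HF] := qr _ qpA K D C.
  have [y yA] : exists y, forall x, x \in F -> A (x * y)%g.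
    have pF := @ultra_proper _ _ (betaP p).
    apply: (@filter_ex _ _ pF).
    elim: F FA {HF} => [|x F IHF] FA; first exact: filterE.
    apply: filterS2 (FA x (mem_head _ _)) (IHF _) => [y Ay IHy z|z zF].
      by rewrite inE => /predU1P[->|/IHy].
    by apply: FA; rewrite inE zF orbT.
  exists [seq (x * y)%g | x <- F] => [_ /mapP[x /yA xA ->] //|].
  have := catches_dilate (rho y) HF; rewrite -!map_comp.
  by under eq_map => x do rewrite /= mulnC -rhoM.
Qed.

Theorem central_rich (A : set S) : central A -> rich A.
Proof.
case=> p [_ pK] pA; have : rich_ideal p; last exact.
by apply: pK; split; [exact: rich_ideal_two_sided|exact: sub0set].
Qed.
End Rich.

(** * The semigroup of m-th powers *)

Definition mth_root (m : nat) (x : mth_powers m) : nat :=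
  projT1 (cid2 (asboolP _ (valP x))).

Lemma mth_rootP (m : nat) (x : mth_powers m) :
  (0 < mth_root x)%N /\ val x = (mth_root x ^ m)%N.
Proof. by rewrite /mth_root; case: cid2. Qed.

Lemma mth_rootM (m : nat) (hm : (0 < m)%N) (x y : mth_powers m) :
  mth_root (x * y)%g = (mth_root x * mth_root y)%N.
Proof.
apply/eqP; rewrite -(eqn_exp2r _ _ hm) expnMn.
have [_ <-] := mth_rootP x; have [_ <-] := mth_rootP y.
by have [_ <-] := mth_rootP (x * y)%g.
Qed.

Lemma mth_root_surj (m : nat) (hm : (0 < m)%N) (n : nat) :
  (0 < n)%N -> exists x : mth_powers m, mth_root x = n.
Proof.
move=> n0; have nm : is_mth_power m (n ^ m)%N by apply/asboolP; exists n.
exists (exist _ (n ^ m)%N nm); apply/eqP; rewrite -(eqn_exp2r _ _ hm).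
by have [_ <-] := mth_rootP (exist _ (n ^ m)%N nm).
Qed.

Lemma floor_poly_root_expn (R : realType) (m : nat) (hm : (0 < m)%N)
    (a : {poly int}) (n : nat) :
  floor_poly_root R m a (n ^ m)%N = a.[n%:R].
Proof.
rewrite /floor_poly_root natrX -powR_mulrn ?ler0n // -powRrM mulfV ?pnatr_eq0 -?lt0n //.
rewrite powRr1 ?ler0n // -(rmorph_nat (intmul 1 : int -> R)) horner_map.
exact: intrKfloor.
Qed.

(** * Integer iterates and the action of integer polynomials *)

Section IntegerIterates.
Variables (X : Type) (T g : X -> X).
Hypotheses (TK : cancel T g) (gK : cancel g T).

Definition iterz (z : int) : X -> X :=
  match z with Posz n => iter n T | Negz n => iter n.+1 g end.

Lemma iterzS z x : iterz (z + 1) x = T (iterz z x).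
Proof.
case: z => [n|[|n]]; first by rewrite -PoszD addn1.
  by rewrite /= gK.
have -> : Negz n.+1 + 1 = Negz n by rewrite !NegzE -[n.+2]addn1 PoszD opprD addrNK.
by rewrite /= gK.
Qed.

Lemma iterzD z w x : iterz (z + w) x = iterz z (iterz w x).
Proof.
have pred u y : iterz (u - 1) y = g (iterz u y).
  by rewrite -[in RHS](subrK 1 u) iterzS TK.
elim/int_rect: z => [|n IHn|n IHn]; first by rewrite add0r.
  by rewrite -addn1 PoszD addrAC iterzS IHn iterzS.
by rewrite -addn1 PoszD opprD addrAC pred IHn pred.
Qed.

(** For bijections, the direct images that define negative iterated preimages are
preimages under iterates of the inverse. *)
Lemma preimagezE z U x : preimagez T z U x <-> U (iterz z x).
Proof.
have iterK (h h' : X -> X) n : cancel h h' -> cancel (iter n h) (iter n h').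
  by move=> hK; elim: n => // n IHn y; rewrite (iterSr n h) iterS IHn hK.
case: z => [n|n] //; rewrite /preimagez /iterz.
split=> [[y Uy <-]|Ux]; first by rewrite iterK.
by exists (iter n.+1 g x) => //; rewrite iterK.
Qed.

Lemma iterz_comm (f : X -> X) : (forall x, f (T x) = T (f x)) ->
  forall z x, f (iterz z x) = iterz z (f x).
Proof.
move=> fT; have fg x : f (g x) = g (f x) by rewrite -{2}[x]gK fT TK.
have it h : (forall x, f (h x) = h (f x)) -> forall n x, f (iter n h x) = iter n h (f x).
  by move=> fh; elim=> //= n IHn x; rewrite fh IHn.
by case=> n x; exact: it.
Qed.
End IntegerIterates.

Section Orbit.
Variables (X : topologicalType) (k : nat) (T g : 'I_k -> X -> X).
Hypotheses (TK : forall i, cancel (T i) (g i)) (gK : forall i, cancel (g i) (T i)).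
Hypothesis Tcomm : forall i j x, T i (T j x) = T j (T i x).

Lemma iterzC i j z w x :
  iterz (T i) (g i) z (iterz (T j) (g j) w x) =
  iterz (T j) (g j) w (iterz (T i) (g i) z x).
Proof.
apply: iterz_comm => // y; rewrite (iterz_comm (TK i) (gK i)) // => u.
Qed.

(** With s an enumeration of all indices this is the action of the additive group
of {poly int} in which 'X^i acts as T_i. *)
Definition act_along (s : seq 'I_k) (f : {poly int}) (x : X) : X :=
  foldr (fun i => iterz (T i) (g i) f`_i) x s.

Lemma act_along_iterz s f i z x :
  act_along s f (iterz (T i) (g i) z x) = iterz (T i) (g i) z (act_along s f x).
Proof. by elim: s => //= j s ->; rewrite iterzC. Qed.

Lemma act_alongD s f h x : act_along s (f + h) x = act_along s f (act_along s h x).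
Proof.
elim: s => //= i s ->; rewrite coefD iterzD //.
by rewrite act_along_iterz.
Qed.

Lemma act_along_single s i z x : uniq s -> i \in s ->
  act_along s (z *: 'X^i) x = iterz (T i) (g i) z x.
Proof.
have notin t : i \notin t -> act_along t (z *: 'X^i) x = x.
  elim: t => //= j t IHt; rewrite inE negb_or => /andP[ij it].
  rewrite IHt // coefZ coefXn (inj_eq val_inj) eq_sym (negPf ij) mulr0 //.
elim: s => //= j s IHs /andP[js us]; rewrite inE => /predU1P[ij|si].
  by rewrite -ij in js *; rewrite notin // coefZ coefXn eqxx mulr1.
rewrite IHs // coefZ coefXn (inj_eq val_inj).
by case: eqP js => [->|_ _]; [rewrite si|rewrite mulr0].
Qed.
End Orbit.

(** A point of A, if any, provides the pointed structure under which compactness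
by filters and by open covers are known to agree. *)
Lemma compact_cover_compact (X : topologicalType) (A : set X) :
  compact A -> cover_compact A.
Proof.
have [->|/set0P[x _]] := eqVneq A set0.
  by move=> _ I D f _ _; exists fset0.
pose Xp := HB.pack_for ptopologicalType X (isPointed.Build X x).
have E : compact A = cover_compact A := congr1 (fun P => P A) (@compact_cover Xp).
by rewrite E.
Qed.

(** The points whose full orbit avoids U form a closed set invariant under T, so
minimality leaves none; compactness then bounds the visiting times. *)
Lemma minimal_finite_cover (X : topologicalType) (T g : X -> X) (U : set X) :
  compact [set: X] -> continuous T -> continuous g -> cancel T g -> cancel g T ->
  minimal T -> open U -> U !=set0 ->
  exists zs : seq int, forall x, exists2 z, z \in zs & U (iterz T g z x).
Proof.
move=> cX cT cg TK gK minT oU U0.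
have ci h : continuous h -> forall n, continuous (iter n h : X -> X).
  move=> ch; elim=> [|n IHn] x; first exact: cvg_id.
  exact: (continuous_comp (IHn x) (ch _)).
have oz z : open (iterz T g z @^-1` U).
  by apply: open_comp => // x _; case: z => n; exact: ci.
have visits x : exists z, U (iterz T g z x).
  apply: contrapT => nx; apply: minT.
  exists (~` \bigcup_z (iterz T g z @^-1` U)); split.
  - by exists x => -[z _ Uz]; apply: nx; exists z.
  - by case: U0 => u Uu E; have : [set: X] u by []; rewrite -E; apply; exists 0.
  - apply: (subclosed_compact _ cX) => //.
    by apply: open_closedC; exact: bigcup_open.
  - move=> y nTy [z _ Uz]; apply: nTy; exists (z - 1) => //=.
    by rewrite -[T y]/(iterz T g 1 y) -iterzD // subrK.
move: (compact_cover_compact cX).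
move=> /(_ int setT (fun z => iterz T g z @^-1` U))[|x _|zs _ zsU].
- by move=> z _; exact: oz.
- by have [z Uz] := visits x; exists z.
by exists zs => x; have [z /= zzs Uz] := zsU x I; exists z.
Qed.

(** * Return times *)

(** Its value at n is the element of {poly int} that acts as T_i^(a(n)). *)
Definition along (i : nat) (a : {poly int}) : {poly {poly int}} :=
  ('X^i *: map_poly polyC a)%R.

Lemma horner_along (i : nat) (a : {poly int}) (n : nat) :
  ((along i a).[n%:R] = a.[n%:R] *: 'X^i)%R.
Proof.
by rewrite /along hornerZ -(rmorph_nat polyC) horner_map mulrC mul_polyC.
Qed.

Local Close Scope ring_scope.

Theorem theorem8p11 (R : realType) (k m : nat) (hk : (0 < k)%N) (hm : (0 < m)%N)
    (X : topologicalType) (Xcompact : compact [set: X])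
    (Xhausdorff : hausdorff_space X)
    (T : 'I_k -> X -> X)
    (Thomeo : forall i, homeomorphism (T i))
    (Tminimal : forall i, minimal (T i))
    (Tcomm : forall i j x, T i (T j x) = T j (T i x))
    (U : set X) (Uopen : open U) (Unonempty : U !=set0)
    (a : 'I_k -> {poly int}) (a0 : forall i, (a i).[0]%R = 0%R) :
  central_star
    ((fun x : mth_powers m => val x) @^-1`
       [set n : nat | (0 < n)%N /\
          (U `&` \bigcap_i preimagez (T i) (floor_poly_root R m (a i) n) U)
            !=set0]).
Proof.
move=> C cC; have /choice[g gT] := Thomeo.
have TK i : cancel (T i) (g i) by case: (gT i).
have gK i : cancel (g i) (T i) by case: (gT i).
pose i0 := Ordinal hk; have [u Uu] := Unonempty.
have [zs zsU] : exists zs : seq int, forall x,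
    exists2 z, z \in zs & U (iterz (T i0) (g i0) z x).
  by case: (gT i0) => _ _ cT cg; exact: minimal_finite_cover.
pose orb f := act_along T g (enum 'I_k) f u.
pose inU f z := `[< U (iterz (T i0) (g i0) z (orb f)) >].
pose color f : 'I_(size zs).+1 := inord (find (inU f) zs).
have colorP f : U (iterz (T i0) (g i0) (nth 0%R zs (color f)) (orb f)).
  have zsf : has (inU f) zs.
    by apply/hasP; have [z zz Uz] := zsU (orb f); exists z => //; apply/asboolP.
  rewrite inordK ?ltnS ?find_size //; by apply/asboolP; exact: (nth_find 0%R zsf).
pose P := [seq along i (a i) | i : 'I_k <- enum 'I_k].
have Ps (p : {poly {poly int}}) : p \in P ->
    (size p <= \max_(q <- P) size q)%N /\ (p.[0] = 0)%R.
  move=> pP; split.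
    exact: (@leq_bigmax_seq _ P xpredT (fun q : {poly {poly int}} => size q)).
  by case/mapP: pP => i _ ->; have := horner_along i (a i) 0; rewrite a0 scale0r.
have [F FC HF] :=
  central_rich {poly int} (mth_rootM hm) (mth_root_surj hm) cC k
    (\max_(q <- P) size q) 'I_(size zs).+1.
have [|v [_ [/mapP[x xF ->] Hx]]] := HF P color _ Ps.
  by rewrite size_map size_enum_ord.
exists x; split; last exact: FC.
have [x0 xE] := mth_rootP x; rewrite /= xE expn_gt0 x0; split=> //.
exists (iterz (T i0) (g i0) (nth 0%R zs (color v)) (orb v)); split; first exact: colorP.
move=> i _; apply/(preimagezE (TK i) (gK i)).
rewrite floor_poly_root_expn // iterzC //.
have pP : along i (a i) \in P by apply: map_f; rewrite mem_enum.
(* The translates by v and by v + a_i(n) 'X^i have the same colour, hence visit U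
   at the same time of T i0. *)
have := colorP (v + (along i (a i)).[(mth_root x)%:R])%R.
rewrite Hx // horner_along /orb [(v + _)%R]addrC act_alongD //.
by rewrite act_along_single // ?enum_uniq ?mem_enum.
Qed.
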